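(* Let $G$ be an abelian group that is generalized Bassian. Then $G$ has finite torsion-free rank.
   Context: All groups are abelian. A group $G$ is generalized Bassian if, for every subgroup $N$ of $G$, the existence of an injective homomorphism $G\to G/N$ implies that $N$ is a direct summand of $G$. The torsion-free rank of $G$ is $r_0(G)=\dim_{\mathbb Q}(G\otimes\mathbb Q)$. *)

(* Defs.v *)
From HB Require Import structures.
From mathcomp Require Import all_boot all_algebra.
From mathcomp Require Import boolp.
From mathcomp.multinomials Require Import freeg.

Set Implicit Arguments.
Unset Strict Implicit.
Unset Printing Implicit Defensive.

Import GRing.Theory.
Local Open Scope ring_scope.
Local Open Scope quotient_scope.

Definition direct_summand (G : zmodType) (N : zmodClosed G) : Prop :=
  exists C : zmodClosed G,
    (forall x : G, exists2 n, n \in N & exists2 c, c \in C & x = n + c) /\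
    (forall x : G, x \in N -> x \in C -> x = 0).

(* Membership in a zmodClosed is boolean; by boolp every Prop-valued subgroup
   is of this form, so N ranges over all subgroups of G. *)
Definition generalized_bassian (G : zmodType) : Prop :=
  forall N : zmodClosed G,
    (exists f : {additive G -> Quotient.quot N}, injective f) ->
    direct_summand N.

(* The tensor product of A and B over the integers: the free abelian group on
   A * B modulo the subgroup generated by the biadditivity relations. *)
Section Tensor.
Variables A B : zmodType.

Local Notation free := {freeg (A * B)%type / int}.

Definition tensor_gen (a : A) (b : B) : free := << (a, b) >>.

Definition tensor_rel (x : free) : Prop :=
  (exists a a' b, x = tensor_gen (a + a') b - tensor_gen a b - tensor_gen a' b)
  \/
  (exists a b b', x = tensor_gen a (b + b') - tensor_gen a b - tensor_gen a b').

Definition tensor_null : {pred free} :=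
  fun x => `[< forall S : zmodClosed free,
                 (forall y, tensor_rel y -> y \in S) -> x \in S >].

Lemma tensor_null_zmod_closed : zmod_closed tensor_null.
Proof.
split; first by apply/asboolP => S _; exact: rpred0.
move=> x y /asboolP xN /asboolP yN; apply/asboolP => S SP.
by rewrite rpredB ?xN ?yN.
Qed.

HB.instance Definition _ :=
  GRing.isZmodClosed.Build _ tensor_null tensor_null_zmod_closed.

Definition tensor : Type := Quotient.quot tensor_null.

HB.instance Definition _ := GRing.Zmodule.on tensor.

Definition tens (a : A) (b : B) : tensor :=
  \pi_(Quotient.quot tensor_null) (tensor_gen a b).

Lemma tensor_rel_null x : tensor_rel x -> x \in tensor_null.
Proof. by move=> xR; apply/asboolP => S; apply. Qed.

Lemma pi_tensor_eq x y : x - y \in tensor_null ->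
  \pi_(Quotient.quot tensor_null) x = \pi_(Quotient.quot tensor_null) y.
Proof. by rewrite Quotient.idealrBE => /eqP. Qed.

Lemma tensDl a a' b : tens (a + a') b = tens a b + tens a' b.
Proof.
rewrite /tens -[RHS](raddfD (\pi_(Quotient.quot tensor_null))).
apply: pi_tensor_eq; rewrite opprD addrA.
by apply: tensor_rel_null; left; exists a, a', b.
Qed.

Lemma tensDr a b b' : tens a (b + b') = tens a b + tens a b'.
Proof.
rewrite /tens -[RHS](raddfD (\pi_(Quotient.quot tensor_null))).
apply: pi_tensor_eq; rewrite opprD addrA.
by apply: tensor_rel_null; right; exists a, b, b'.
Qed.

Lemma tensor_ind (P : tensor -> Prop) :
  P 0 -> (forall x y, P x -> P y -> P (x - y)) ->
  (forall a b, P (tens a b)) -> forall x, P x.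
Proof.
move=> P0 PB Pt x.
have PN y : P y -> P (- y) by move=> Py; rewrite -sub0r; exact: PB.
have PD y z : P y -> P z -> P (y + z).
  by move=> Py Pz; rewrite -[z]opprK; apply: PB => //; exact: PN.
rewrite -[x](@reprK _ (Quotient.quot tensor_null)) -[repr _]freeg_sumE.
rewrite (raddf_sum (\pi_(Quotient.quot tensor_null))); elim/big_ind: _ => // -[a b] _.
have -> z : << z *g (a, b) >> = tensor_gen a b *~ z :> free.
  by rewrite freegU_mulz intz.
have Pn n : P (tens a b *+ n).
  by elim: n => [|n IHn]; rewrite ?mulr0n // mulrS; exact: PD.
rewrite (raddfMz (\pi_(Quotient.quot tensor_null))); case: (coeff _ _) => n; first exact: Pn.
by rewrite NegzE mulrNz; apply: PN; exact: Pn.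
Qed.

Section Lift.
Variables (M : zmodType) (f : A -> B -> M).
Hypothesis fDl : forall a a' b, f (a + a') b = f a b + f a' b.
Hypothesis fDr : forall a b b', f a (b + b') = f a b + f a b'.

Let lift0 (x : free) : zmodule M :=
  fglift (fun ab => f ab.1 ab.2 : zmodule M) x.

Let lift0B x y : lift0 (x - y) = lift0 x - lift0 y.
Proof. exact: lift_is_additive. Qed.

Let lift0_gen a b : lift0 (tensor_gen a b) = f a b.
Proof. by rewrite /lift0 liftU scale1r. Qed.

Let ker : {pred free} := fun x => lift0 x == 0.

Let ker_zmod_closed : zmod_closed ker.
Proof.
split=> [|x y]; rewrite !unfold_in /ker; last first.
  by move=> /eqP x0 /eqP y0; rewrite lift0B x0 y0 subrr.
by rewrite -(subrr 0) lift0B subrr.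
Qed.

Let kerT := HB.pack_for (zmodClosed free) ker
  (GRing.isZmodClosed.Build _ ker ker_zmod_closed).

Let lift0_null x : x \in tensor_null -> lift0 x = 0.
Proof.
move=> /asboolP/(_ kerT) xN; apply/eqP; apply: xN => y.
move=> [[a [a' [b ->]]]|[a [b [b' ->]]]];
  by rewrite unfold_in /= /ker !lift0B !lift0_gen ?fDl ?fDr addrAC addrK subrr.
Qed.

Definition tensor_lift (x : tensor) : M :=
  lift0 (repr (x : Quotient.quot tensor_null)).

Let lift_pi x : tensor_lift (\pi_(Quotient.quot tensor_null) x) = lift0 x.
Proof.
apply/eqP; rewrite -subr_eq0 -[_ - _]lift0B; apply/eqP/lift0_null.
by rewrite Quotient.idealrBE reprK.
Qed.

Lemma tensor_liftB : zmod_morphism tensor_lift.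
Proof.
move=> x y; rewrite -[x](@reprK _ (Quotient.quot tensor_null)).
rewrite -[y](@reprK _ (Quotient.quot tensor_null)).
rewrite -[X in tensor_lift X](raddfB (\pi_(Quotient.quot tensor_null))).
by rewrite !lift_pi lift0B.
Qed.

Lemma tensor_liftE a b : tensor_lift (tens a b) = f a b.
Proof. by rewrite lift_pi lift0_gen. Qed.

End Lift.
End Tensor.

(* The tensor product of G and rat as a vector space over rat, the scalars
   acting through the second factor. *)
Definition tensorQ (G : zmodType) : Type := tensor G rat.

HB.instance Definition _ (G : zmodType) := GRing.Zmodule.on (tensorQ G).

Section TensorQ.
Variable G : zmodType.

Definition tensorQ_scale (c : rat) : tensorQ G -> tensorQ G :=
  tensor_lift (fun a q => tens a (c * q)).

Lemma tensorQ_scaleB c : zmod_morphism (tensorQ_scale c).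
Proof.
by apply: tensor_liftB => *; rewrite ?mulrDr ?tensDl ?tensDr.
Qed.

Lemma tensorQ_scaleE c a q : tensorQ_scale c (tens a q) = tens a (c * q).
Proof.
by apply: tensor_liftE => *; rewrite ?mulrDr ?tensDl ?tensDr.
Qed.

HB.instance Definition _ c :=
  GRing.isZmodMorphism.Build (tensorQ G) (tensorQ G) (tensorQ_scale c)
    (tensorQ_scaleB c).

Lemma tensorQ_scaleA a b x :
  tensorQ_scale a (tensorQ_scale b x) = tensorQ_scale (a * b) x.
Proof.
elim/tensor_ind: x => [|x y IHx IHy|g q]; first by rewrite !raddf0.
  by rewrite !raddfB /= IHx IHy.
by rewrite !tensorQ_scaleE mulrA.
Qed.

Lemma tensorQ_scale1 : left_id 1 tensorQ_scale.
Proof.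
elim/tensor_ind => [|x y IHx IHy|g q]; first by rewrite raddf0.
  by rewrite raddfB /= IHx IHy.
by rewrite tensorQ_scaleE mul1r.
Qed.

Lemma tensorQ_scaleDr : right_distributive tensorQ_scale +%R.
Proof. by move=> c x y; rewrite raddfD. Qed.

Lemma tensorQ_scaleDl x : {morph tensorQ_scale^~ x : a b / a + b}.
Proof.
move=> a b; elim/tensor_ind: x => [|x y IHx IHy|g q].
- by rewrite !raddf0 addr0.
- by rewrite !raddfB /= IHx IHy opprD addrACA.
- by rewrite !tensorQ_scaleE mulrDl tensDr.
Qed.

HB.instance Definition _ := GRing.Zmodule_isLmodule.Build rat (tensorQ G)
  tensorQ_scaleA tensorQ_scale1 tensorQ_scaleDr tensorQ_scaleDl.

Lemma tensorQ_scale_tens (c : rat) (a : G) (q : rat) :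
  c *: (tens a q : tensorQ G) = tens a (c * q).
Proof. exact: tensorQ_scaleE. Qed.

End TensorQ.

(* dim_Q (G (x) Q) = n. *)
Definition torsion_free_rank_eq (G : zmodType) (n : nat) : Prop :=
  exists phi : {linear tensorQ G -> 'rV[rat]_n}, bijective phi.

Definition finite_torsion_free_rank (G : zmodType) : Prop :=
  exists n : nat, torsion_free_rank_eq G n.

(* Main.v *)
From HB Require Import structures.
Require Import Defs.
From mathcomp Require Import all_boot all_algebra.
From mathcomp Require Import boolp classical_sets.

(** Suppose that G has infinite torsion-free rank. Then G contains a free
subgroup of countably infinite rank, that is, there is an injective additive
map beta from the group A of integer polynomials to G
([finite_dim_or_free_seq], [poly_comb]). A suitable subgroup N of beta(A) is
then not a direct summand although G embeds into G/N
([not_bassian_of_free]).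

The group N is a kernel. Let D be the group of rational polynomials and Z its
subgroup of integer constants. As D is countable and A is free of infinite
rank, there is a surjective additive rho : A -> D; put N = beta(rho^-1(Z)).

G embeds into G/N because beta(A)/N is isomorphic to the divisible group D/Z,
so it splits off G/N with a complement isomorphic to G/beta(A), and it is large
enough to contain another copy of A, through alpha : p |-> X p. Hence
A -> D/Z extends to G -> D/Z and, together with the projection
G -> G/beta(A), gives an injective map from G to D/Z + G/beta(A), which is G/N.
[embed_in_quotient] writes this map in one formula,
g |-> g + beta(s(delta g)) mod N, where s is a set-theoretic section of rho
and delta : G -> D extends alpha - rho along beta. That extension exists since
rational vector spaces are injective abelian groups ([extend_to_rat_space]).

N is not a summand because it is not pure: if rho(e) = 1/2, then 2 beta(e)
lies in N; a summand N would also contain some beta(p) with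
2 beta(p) = 2 beta(e), and then p = e as A is torsion-free, whereas 1/2 is not
an integer. *)

Set Implicit Arguments.
Unset Strict Implicit.
Unset Printing Implicit Defensive.

Import GRing.Theory.
Local Open Scope ring_scope.

(** * Maps and subgroups given by propositions *)

Lemma additive_of (U V : zmodType) (f : U -> V) :
  zmod_morphism f -> exists F : {additive U -> V}, F =1 f.
Proof.
move=> fB.
by exists (HB.pack_for {additive U -> V} f
             (GRing.isZmodMorphism.Build U V f fB)).
Qed.

Lemma zmodClosed_of (G : zmodType) (P : G -> Prop) :
  P 0 -> (forall x y, P x -> P y -> P (x - y)) ->
  exists S : zmodClosed G, forall x, x \in S <-> P x.
Proof.
move=> P0 PB; pose S : {pred G} := fun x => `[< P x >].
have SP : zmod_closed S.
  by split=> [|x y /asboolP Px /asboolP Py]; apply/asboolP; [|exact: PB].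
exists (HB.pack_for (zmodClosed G) S (GRing.isZmodClosed.Build G S SP)) => x.
by split=> /asboolP.
Qed.

Lemma subrACA (V : zmodType) (x y z t : V) : x - y - (z - t) = x - z - (y - t).
Proof. by rewrite !opprB addrACA [RHS]addrACA [- y - z]addrC. Qed.

(** * Extension of homomorphisms into rational vector spaces *)

(** Zorn's lemma. If no nonzero multiple of g lies in C + beta(A), then the
subgroup generated by C and g still meets beta(A) trivially, against the
maximality of C: so C + beta(A) has torsion quotient. *)
Lemma maximal_disjoint_subgroup (A G : zmodType) (beta : {additive A -> G}) :
  exists C : zmodClosed G,
    (forall a, beta a \in C -> beta a = 0) /\
    (forall g, exists n a, n != 0 :> int /\ g *~ n - beta a \in C).
Proof.
pose P (X : set G) := (forall x y, X x -> X y -> X (x - y)) /\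
                      (forall a, X (beta a) -> beta a = 0).
have [|X [[XB Xd] Xmax]] := @Zorn_bigcup G P.
  move=> F FP Ftot; split=> [x y [U FU Ux] [W FW Wy]|a [U FU Ua]].
    have [UW|WU] := Ftot _ _ FU FW.
      by exists W => //; apply: (FP _ FW).1 => //; exact: UW.
    by exists U => //; apply: (FP _ FU).1 => //; exact: WU.
  exact: (FP _ FU).2 Ua.
(* The conditions on X do not force 0 into it, and the union of the empty
   chain is empty; but a maximal X is not empty. *)
have X0 : X 0.
  apply: contrapT => nX0; apply: (Xmax [set 0]%classic).
    split=> [x Xx|/(_ 0 erefl)//].
    by case: nX0; rewrite -(subrr x); exact: XB.
  by split=> [x y -> ->|a //]; rewrite /= subrr.
have [C CX] := zmodClosed_of X0 XB.
exists C; split=> [a /CX|g]; first exact: Xd.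
have [Cg|nCg] := boolP (g \in C).
  by exists 1, 0; rewrite raddf0 subr0.
pose B : set G := fun x => exists k : int, x - g *~ k \in C.
have : ~ P B.
  apply: Xmax; split.
    by move=> x /CX Cx; exists 0; rewrite mulr0z subr0.
  move=> /(_ g) BX; move/negP: nCg; apply; apply/CX/BX.
  by exists 1; rewrite subrr rpred0.
apply: contra_notP => ng; split=> [x y [k Ck] [l Cl]|a [k Ck]].
  by exists (k - l); rewrite mulrzBr subrACA rpredB.
have [k0|k0] := eqVneq k 0.
  by apply/Xd/CX; move: Ck; rewrite k0 mulr0z subr0.
by case: ng; exists k, a; rewrite -opprB rpredN.
Qed.

(** With C as above, each g satisfies g n = c + beta(a) for some nonzero n and
c in C. An extension that vanishes on C has to send g to eta(a)/n; this value
does not depend on the choices because C meets beta(A) trivially. *)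
Lemma extend_to_rat_space (A G : zmodType) (D : lmodType rat)
    (beta : {additive A -> G}) (eta : {additive A -> D}) :
  injective beta -> exists delta : {additive G -> D},
    forall a, delta (beta a) = eta a.
Proof.
move=> beta_inj.
have [C [Cd Cmax]] := maximal_disjoint_subgroup beta.
pose R g d := exists n a, [/\ n != 0 :> int, g *~ n - beta a \in C &
                              n%:~R *: d = eta a].
have Rfun g : exists d, R g d.
  have [n [a [n0 Ca]]] := Cmax g.
  exists (n%:~R^-1 *: eta a), n, a; split=> //.
  by rewrite scalerA mulfV ?scale1r // intr_eq0.
have Runiq g d d' : R g d -> R g d' -> d = d'.
  move=> [n [a [n0 Ca da]]] [m [b [m0 Cb db]]].
  have /beta_inj E : beta (a *~ m) = beta (b *~ n).
    apply/eqP; rewrite -subr_eq0 -raddfB; apply/eqP/Cd.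
    rewrite raddfB /= !(raddfMz beta).
    have -> : beta a *~ m - beta b *~ n =
      (g *~ m - beta b) *~ n - (g *~ n - beta a) *~ m.
      by rewrite !mulrzBl -!mulrzA [(n * m)%R]mulrC subrACA subrr sub0r opprB.
    by rewrite rpredB // rpredMz.
  have mn0 : (m * n)%:~R != 0 :> rat by rewrite intr_eq0 mulf_neq0.
  apply: (scalerI mn0); rewrite {1}intrM -scalerA da mulrC intrM -scalerA db.
  by rewrite !scaler_int -!(raddfMz eta) E.
have RB g g' d d' : R g d -> R g' d' -> R (g - g') (d - d').
  move=> [n [a [n0 Ca da]]] [m [b [m0 Cb db]]].
  exists (m * n), (a *~ m - b *~ n); split; first by rewrite mulf_neq0.
    have -> : (g - g') *~ (m * n) - beta (a *~ m - b *~ n) =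
       (g *~ n - beta a) *~ m - (g' *~ m - beta b) *~ n.
      by rewrite raddfB /= !(raddfMz beta) !mulrzBl -!mulrzA
        [(n * m)%R]mulrC subrACA.
    by rewrite rpredB // rpredMz.
  rewrite scalerBr {1}intrM -scalerA da mulrC intrM -scalerA db.
  by rewrite !scaler_int raddfB /= !(raddfMz eta).
have [f fR] := choice Rfun.
have fB : zmod_morphism f.
  by move=> x y; apply: (Runiq (x - y)) => //; apply: RB.
have [delta deltaE] := additive_of fB.
exists delta => a; rewrite deltaE; apply: (Runiq (beta a)) => //.
by exists 1, a; rewrite subrr rpred0 scale1r.
Qed.

(** * A quotient by a free subgroup that contains the group *)

(** The map is g |-> g + beta(s(delta g)) mod N, with s a section of rho and
delta an extension of alpha - rho along beta. It is additive because s is so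
modulo the kernel of rho. If g is killed then g = beta(a) for some a, and
rho(a) + delta(beta a) = alpha(a) lies in Z, so that a = 0. *)
Lemma embed_in_quotient (A G : zmodType) (D : lmodType rat)
    (beta : {additive A -> G}) (alpha rho : {additive A -> D})
    (Z : zmodClosed D) (N : zmodClosed G) :
  injective beta -> (forall d, exists a, rho a = d) ->
  (forall a, alpha a \in Z -> a = 0) ->
  (forall g, g \in N <-> exists2 a, rho a \in Z & g = beta a) ->
  exists f : {additive G -> Quotient.quot N}, injective f.
Proof.
move=> beta_inj rho_surj alphaZ NP.
have [eta etaE] : exists eta : {additive A -> D},
    eta =1 (fun a => alpha a - rho a).
  by apply: additive_of => a b; rewrite (raddfB alpha) (raddfB rho) /= subrACA.
have [delta deltaE] := extend_to_rat_space eta beta_inj.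
have [s sE] := choice rho_surj.
pose f g : Quotient.quot N :=
  (\pi_(Quotient.quot N) (g + beta (s (delta g))))%qT.
have fE g h : g - h \in N ->
    (\pi_(Quotient.quot N) g = \pi_(Quotient.quot N) h)%qT.
  by rewrite Quotient.idealrBE => /eqP.
have fB : zmod_morphism f.
  move=> g h; rewrite /f -[RHS](raddfB (\pi_(Quotient.quot N)%qT)).
  apply: fE; apply/NP.
  exists (s (delta (g - h)) - (s (delta g) - s (delta h))).
    by rewrite (raddfB rho) (raddfB rho) !sE (raddfB delta) subrr rpred0.
  rewrite (raddfB beta) (raddfB beta).
  have -> : g + beta (s (delta g)) - (h + beta (s (delta h))) =
    g - h + (beta (s (delta g)) - beta (s (delta h))) by rewrite opprD addrACA.
  by rewrite [X in X - _]addrC addrKA.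
have [F FE] := additive_of fB.
exists F; apply: raddf_inj => g; rewrite FE /f => Fg.
have : g + beta (s (delta g)) \in N.
  by rewrite -[_ + _]subr0 Quotient.idealrBE Fg raddf0.
move=> /NP [b Zb gE].
have {}gE : g = beta (b - s (delta g)) by rewrite raddfB /= -gE addrK.
suff a0 : b - s (delta g) = 0 by rewrite gE a0 raddf0.
apply: alphaZ; have := deltaE (b - s (delta g)).
rewrite -gE etaE (raddfB rho) sE opprB addrCA => /eqP.
by rewrite [X in _ == X]addrC -subr_eq subrr eq_sym subr_eq0 => /eqP ->.
Qed.

(** Integer polynomials serve as the free abelian group on the monomials. *)
Lemma poly_comb (M : zmodType) (b : nat -> M) :
  exists beta : {additive {poly int} -> M},
    forall (p : {poly int}) n, (size p <= n)%N ->
      beta p = \sum_(i < n) b i *~ p`_i.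
Proof.
pose f (p : {poly int}) := \sum_(i < size p) b i *~ p`_i.
have fE (p : {poly int}) n : (size p <= n)%N -> f p = \sum_(i < n) b i *~ p`_i.
  move=> pn; rewrite /f (big_ord_widen _ (fun i => b i *~ p`_i) pn).
  rewrite big_mkcond; apply: eq_bigr => i _; case: ifP => // /negbT.
  by rewrite -leqNgt => /(nth_default 0) ->; rewrite mulr0z.
have fB : zmod_morphism f.
  move=> p q; pose n := maxn (size p) (size q).
  rewrite (fE p n) ?leq_maxl // (fE q n) ?leq_maxr //.
  rewrite (fE _ n) ?(leq_trans (size_polyD _ _)) ?size_polyN //.
  rewrite -sumrB; apply: eq_bigr => i _.
  by rewrite coefB mulrzBr.
have [beta betaE] := additive_of fB.
by exists beta => p n /fE <-; exact: betaE.
Qed.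

(** Here Z consists of the integer constants: it contains no nonzero multiple
of X, which makes the embedding injective, and it omits 1/2 but contains
1 = 2 (1/2), which makes N impure. *)
Lemma not_bassian_of_free (G : zmodType) (beta : {additive {poly int} -> G}) :
  injective beta -> ~ generalized_bassian G.
Proof.
move=> beta_inj.
pose D := {poly rat}.
have [rho rhoE] := poly_comb (fun i => odflt 0 (unpickle i) : D).
have rho_surj d : exists a, rho a = d.
  (* The monomials are sent onto an enumeration of all of D. *)
  exists 'X^(pickle d); rewrite (rhoE _ (pickle d).+1) ?size_polyXn //.
  rewrite big_ord_recr big1 /= ?add0r => [|i _].
    by rewrite coefXn eqxx pickleK mulr1z.
  by rewrite coefXn ltn_eqF.
have [alpha alphaE] : exists alpha : {additive {poly int} -> D},
    alpha =1 (fun p => 'X * map_poly intr p).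
  by apply: additive_of => p q; rewrite rmorphB mulrBr.
have [Z ZP] : exists Z : zmodClosed D,
    forall d, d \in Z <-> exists k : int, d = k%:~R%:P.
  apply: zmodClosed_of; first by exists 0.
  by move=> _ _ [k ->] [l ->]; exists (k - l); rewrite intrB polyCB.
have alphaZ p : alpha p \in Z -> p = 0.
  move=> /ZP[k]; rewrite alphaE => /polyP pk; apply/polyP => i.
  have := pk i.+1; rewrite coefXM coefC /= coef_map coef0 => /eqP.
  by rewrite intr_eq0 => /eqP.
have [N NP] : exists N : zmodClosed G,
    forall g, g \in N <-> exists2 a, rho a \in Z & g = beta a.
  apply: zmodClosed_of; first by exists 0; rewrite ?raddf0 ?rpred0.
  by move=> _ _ [a Za ->] [b Zb ->]; exists (a - b); rewrite raddfB ?rpredB.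
move=> /(_ N (embed_in_quotient beta_inj rho_surj alphaZ NP)) [C [NC NC0]].
have [e eE] := rho_surj (2%:R^-1)%:P.
have N2e : beta e *+ 2 \in N.
  apply/NP; exists (e *+ 2); last by rewrite raddfMn.
  by apply/ZP; exists 1; rewrite (raddfMn rho) eE -polyCMn.
have [x Nx [c Cc ec]] := NC (beta e).
have c2 : c *+ 2 = 0.
  apply: NC0; last by rewrite rpredMn.
  have -> : c *+ 2 = beta e *+ 2 - x *+ 2.
    by rewrite ec mulrnDl [x *+ 2 + _]addrC addrK.
  by rewrite rpredB // rpredMn.
have /NP[p Zp xE] := Nx.
have /beta_inj/eqP : beta (e *+ 2) = beta (p *+ 2).
  by rewrite !raddfMn /= ec mulrnDl c2 addr0 xE.
rewrite -subr_eq0 -mulrnBl -mulr_natr mulf_eq0 subr_eq0.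
rewrite -polyC1 -polyCMn polyC_eq0 orbF => /eqP ep.
move: Zp; rewrite -ep eE => /ZP[k /polyC_inj k2].
have : (k * 2)%:~R = 1 :> rat by rewrite intrM -k2 mulVf.
move=> /eqP; rewrite -[1]/(1%:~R) eqr_int => /eqP /(congr1 absz).
by rewrite abszM; case: `|k|%N => [|[|]].
Qed.

(** * Infinite dimension and free sequences *)

(** The coefficients form a sequence on all of nat, so that n may vary without
any cast. *)
Definition in_span (K : fieldType) (V : lmodType K) (v : nat -> V) (n : nat)
  (x : V) := exists a : nat -> K, x = \sum_(i < n) a i *: v i.

Lemma eq_in_span (K : fieldType) (V : lmodType K) (v w : nat -> V) n x :
  (forall i, (i < n)%N -> v i = w i) -> in_span v n x -> in_span w n x.
Proof.
by move=> vw [a ->]; exists a; apply: eq_bigr => i _; rewrite vw.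
Qed.

(** In a nontrivial relation, the last vector with a nonzero coefficient would
be in the span of the vectors that precede it. *)
Lemma free_coef0 (K : fieldType) (V : lmodType K) (v : nat -> V) n :
  (forall k, (k < n)%N -> ~ in_span v k (v k)) ->
  forall a : nat -> K, \sum_(i < n) a i *: v i = 0 ->
    forall i, (i < n)%N -> a i = 0.
Proof.
elim: n => // n IHn vfree a; rewrite big_ord_recr /= => sum0.
have an0 : a n = 0.
  apply: contrapT => /eqP an0; apply: (vfree n) => //.
  exists (fun i => - ((a n)^-1 * a i)).
  apply: (scalerI an0); rewrite scaler_sumr.
  move: sum0 => /eqP; rewrite addrC addr_eq0 => /eqP ->.
  rewrite -sumrN; apply: eq_bigr => i _.
  by rewrite scalerA mulrN mulrA mulfV // mul1r scaleNr.
move: sum0; rewrite an0 scale0r addr0 => sum0 i.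
rewrite ltnS leq_eqVlt => /orP[/eqP -> //|lin].
by apply: IHn => // k kn; apply: vfree; rewrite ltnS ltnW.
Qed.

Lemma linear_iso_of_basis (K : fieldType) (V : lmodType K) (v : nat -> V) n :
  (forall k, (k < n)%N -> ~ in_span v k (v k)) ->
  (forall x, in_span v n x) ->
  exists phi : {linear V -> 'rV[K]_n}, bijective phi.
Proof.
move=> vfree /choice[c cE].
have cU x (a : nat -> K) : x = \sum_(i < n) a i *: v i ->
    forall i, (i < n)%N -> c x i = a i.
  move=> xE i lin; apply/eqP; rewrite -subr_eq0; apply/eqP.
  apply: (free_coef0 vfree (a := fun i => c x i - a i)) => //.
  under eq_bigr do rewrite scalerBl.
  by rewrite sumrB -cE -xE subrr.
pose f x : 'rV[K]_n := \row_i c x i.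
have flin : linear f.
  move=> k x y; apply/rowP => i; rewrite !mxE.
  apply: (cU _ (fun i => k * c x i + c y i)) => //.
  rewrite {1}(cE x) {1}(cE y) scaler_sumr -big_split; apply: eq_bigr => j _ /=.
  by rewrite scalerDl scalerA.
exists (HB.pack_for {linear V -> 'rV[K]_n} f
         (GRing.isLinear.Build K V 'rV[K]_n *:%R f flin)).
exists (fun r : 'rV[K]_n => \sum_(i < n) r 0 i *: v i) => [x|r] /=.
  by rewrite [RHS]cE; apply: eq_bigr => i _; rewrite mxE.
apply/rowP => i; rewrite mxE.
(* The row r, continued by 0 to a sequence on nat. *)
pose a j := if insub j is Some k then r 0 k else 0 : K.
have aE (j : 'I_n) : a j = r 0 j by rewrite /a valK.
rewrite -aE; apply: (cU _ a) => //.
by apply: eq_bigr => j _; rewrite aE.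
Qed.

(** Greedy choice: as long as the vectors already taken do not span V, some
tau t lies outside their span, and it is taken next. *)
Lemma finite_dim_or_free_seq (T : Type) (t0 : T) (K : fieldType)
    (V : lmodType K) (tau : T -> V) :
  (forall v n, (forall t, in_span v n (tau t)) -> forall x, in_span v n x) ->
  (exists n, exists phi : {linear V -> 'rV[K]_n}, bijective phi) \/
  (exists b : nat -> T, forall k, ~ in_span (tau \o b) k (tau (b k))).
Proof.
move=> tau_span; have [|infV] := pselect (exists n,
  exists phi : {linear V -> 'rV[K]_n}, bijective phi); [by left|right].
pose v s i := tau (nth t0 s i).
have /choice[next nextP] (s : seq T) : exists t,
    (forall k, (k < size s)%N -> ~ in_span (v s) k (v s k)) ->
    ~ in_span (v s) (size s) (tau t).
  have [sfree|] := pselect (forall k, (k < size s)%N ->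
      ~ in_span (v s) k (v s k)).
    apply: contrapT => nex; apply: infV; exists (size s).
    apply: (linear_iso_of_basis sfree); apply: tau_span => t.
    by apply: contrapT => nt; apply: nex; exists t.
  by exists t0.
pose s n := iter n (fun s => rcons s (next s)) [::].
pose b n := next (s n).
have sE n : s n = mkseq b n.
  elim: n => // n IHn; rewrite /mkseq -addn1 iotaD map_cat.
  by rewrite -/(mkseq b n) -IHn cats1 addn1.
have vE n k i : (k <= n)%N -> (i < k)%N -> v (s n) i = tau (b i).
  by move=> kn ik; rewrite /v sE nth_mkseq // (leq_trans ik).
exists b => k; elim/ltn_ind: k => k IHk spank.
apply: (nextP (s k)); rewrite sE size_mkseq -sE; last first.
  by apply: eq_in_span spank => i ik; rewrite (vE k k).
move=> i ik spani; apply: (IHk i ik).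
rewrite -(vE k k i) //; apply: eq_in_span spani => j ji.
by rewrite (vE k k) // (ltn_trans ji).
Qed.

(** * Generalized Bassian groups *)

Theorem theorem3p5 (G : zmodType) :
  generalized_bassian G -> finite_torsion_free_rank G.
Proof.
pose tau (g : G) : tensorQ G := tens g 1.
have tauB : zmod_morphism tau.
  move=> x y; apply/eqP; rewrite eq_sym subr_eq; apply/eqP.
  by rewrite -[LHS]/(tens x 1) /tau -tensDl subrK.
have [tauF tauE] := additive_of tauB.
have [|//|[b bfree] gbG] := @finite_dim_or_free_seq G 0 rat (tensorQ G) tau.
  move=> v n spant; elim/tensor_ind => [|x y [a ->] [c ->]|g q].
  - by exists (fun=> 0); rewrite big1 // => i _; rewrite scale0r.
  - exists (fun i => a i - c i); rewrite -sumrB.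
    by apply: eq_bigr => i _; rewrite scalerBl.
  - have [a aE] := spant g; exists (fun i => q * a i).
    rewrite -[q in LHS]mulr1 -[LHS]tensorQ_scale_tens -/(tau g) aE scaler_sumr.
    by apply: eq_bigr => i _; rewrite scalerA.
have [beta betaE] := poly_comb b.
case: (@not_bassian_of_free G beta) => //.
apply: raddf_inj => p bp; apply/polyP => i; rewrite coef0.
have [lip|/(nth_default 0) //] := ltnP i (size p).
apply/eqP; rewrite -(intr_eq0 rat); apply/eqP.
(* A relation between the b j in G becomes a linear relation between their
   images in the tensor product, where the b j are independent. *)
pose a j : rat := (p`_j)%:~R.
have sum0 : \sum_(j < size p) a j *: tau (b j) = 0.
  transitivity (tauF (beta p)); last by rewrite bp raddf0.
  rewrite (betaE p _ (leqnn _)) raddf_sum; apply: eq_bigr => j _.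
  by rewrite raddfMz /= tauE scaler_int.
exact: (free_coef0 (fun k _ => bfree k) sum0 lip).
Qed.
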